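(* Let $d\ge 1$ be an integer and let $T\in\mathbb{M}_d(\mathbb{C})$. Then $\mathrm{Sym}_1(T)=\mathcal{U}(T)$ if and only if $T$ is normal and has at most two (distinct) eigenvalues.
   Context: A symmetry on $\mathbb{C}^d$ is an operator $J$ with $J=J^*=J^{-1}$; $\mathrm{Sym}_1(\mathbb{C}^d)$ is the set of symmetries. $\mathcal{U}(T)=\{U^*TU: U\text{ unitary on }\mathbb{C}^d\}$ is the unitary orbit of $T$, and $\mathrm{Sym}_1(T)=\{J^*TJ: J\in\mathrm{Sym}_1(\mathbb{C}^d)\}$. *)

(* Defs.v *)
From mathcomp Require Import all_boot all_order all_algebra.
From mathcomp Require Import complex.
From mathcomp Require Import boolp classical_sets functions cardinality reals.

Set Implicit Arguments.
Unset Strict Implicit.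
Unset Printing Implicit Defensive.

Import Order.TTheory GRing.Theory Num.Theory.

Local Open Scope classical_set_scope.
Local Open Scope ring_scope.
Local Open Scope sesquilinear_scope.
Local Open Scope complex_scope.

(* The unitmx conjunct is needed because invmx J is J itself when J is
   singular. *)
Definition symmetries (R : realType) (d : nat) : set 'M[R[i]]_d :=
  [set J | [/\ J \in unitmx, J = J^t* & J = invmx J]].

Definition unitary_orbit (R : realType) (d : nat) (T : 'M[R[i]]_d) :
    set 'M[R[i]]_d :=
  [set U^t* *m T *m U | U in [set U : 'M[R[i]]_d | U \is unitarymx]].

Definition symmetry_orbit (R : realType) (d : nat) (T : 'M[R[i]]_d) :
    set 'M[R[i]]_d :=
  [set J^t* *m T *m J | J in @symmetries R d].

(* eigenvalue refers to row eigenvectors (v *m T = a *: v); for a square matrix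
   over a field these have the same eigenvalues as column eigenvectors. *)
Definition spectrum (R : realType) (d : nat) (T : 'M[R[i]]_d) : set R[i] :=
  [set a | eigenvalue T a].

(* Main.v *)
Require Import Defs.
From mathcomp Require Import all_boot all_order all_algebra all_fingroup.
From mathcomp Require Import complex ring.
From mathcomp Require Import boolp classical_sets functions cardinality reals.

(** Necessity. If [J T J = S] for a symmetry [J], then [J] swaps [T] and [S], so
    [tr (T S^* )] = [tr (S T^* )]. Applied to [S = U^* T U] with
    [U = 1 + ('i - 1) p], [p] the projection on a unit vector [x], this says
    that the quadratic form of the hermitian commutator [T T^* - T^* T] vanishes
    at [x]; hence [T] is normal. If a normal [T] had three distinct eigenvalues,
    let [U] permute three corresponding orthonormal eigenvectors cyclically: some
    vector has [T]-eigenvalue [a] and [S]-eigenvalue [b], and [J] would send it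
    to one with these roles exchanged, but there is none.

    Sufficiency. For eigenvalues [a], [b] we have [T = b + (a - b) X^* X] where the rows of [X] are
    orthonormal, and it suffices to exchange the projections [X^* X] and
    [Y^* Y] for [Y = X U]. By the polar decomposition the frame [Y] of its row
    space can be chosen so that [X Y^*] is hermitian; then [X + Y] is orthogonal
    to [X - Y], and the reflection negating the row space of [X - Y] maps [X]
    to [Y]. *)

Set Implicit Arguments.
Unset Strict Implicit.
Unset Printing Implicit Defensive.

Import Order.TTheory GRing.Theory Num.Theory.

Local Open Scope classical_set_scope.
Local Open Scope card_scope.
Local Open Scope ring_scope.
Local Open Scope sesquilinear_scope.

Section Orbits.
Context {C : numClosedFieldType}.

(** * Adjoints, unitary matrices and the hermitian form *)

Lemma adjmxM m n p (A : 'M[C]_(m, n)) (B : 'M[C]_(n, p)) :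
  (A *m B)^t* = B^t* *m A^t*.
Proof. by rewrite trmx_mul map_mxM. Qed.

Lemma adjmxD m n (A B : 'M[C]_(m, n)) : (A + B)^t* = A^t* + B^t*.
Proof. by rewrite linearD map_mxD. Qed.

Lemma adjmxB m n (A B : 'M[C]_(m, n)) : (A - B)^t* = A^t* - B^t*.
Proof. by rewrite linearB map_mxB. Qed.

Lemma adjmxZ m n a (A : 'M[C]_(m, n)) : (a *: A)^t* = a^* *: A^t*.
Proof. by rewrite linearZ map_mxZ. Qed.

Lemma adjmx_scalar n (a : C) : (a%:M : 'M_n)^t* = (a^*)%:M.
Proof. by rewrite tr_scalar_mx map_scalar_mx. Qed.

Lemma adjmx_diag n (c : 'rV[C]_n) : (diag_mx c)^t* = diag_mx (map_mx Num.conj c).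
Proof. by rewrite tr_diag_mx map_diag_mx. Qed.

Lemma unitarymxPC n {U : 'M[C]_n} : U \is unitarymx -> U^t* *m U = 1%:M.
Proof. by move=> /unitarymxP /mulmx1C. Qed.

Lemma mulmx_adj_dotmx n (u v : 'rV[C]_n) : u *m v^t* = (dotmx u v)%:M.
Proof. by rewrite dotmxE -mx11_scalar. Qed.

Lemma mulmx_adj_eq0 n (u : 'rV[C]_n) : u *m u^t* = 0 -> u = 0.
Proof.
rewrite mulmx_adj_dotmx => /(congr1 (fun A : 'M_1 => A 0 0)); rewrite !mxE /= mulr1n => u0.
by apply/eqP; apply: contraT => /dotmx_is_dotmx; rewrite u0 ltxx.
Qed.

Lemma mulmx_row_adj m n (A B : 'M[C]_(m, n)) i :
  row i A *m (row i B)^t* = ((A *m B^t*) i i)%:M.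
Proof.
by rewrite [LHS]mx11_scalar !mxE; congr (_%:M); apply: eq_bigr => j _; rewrite !mxE.
Qed.

(** * Orthonormal completion and polar decomposition *)

Lemma normalize_row n (v : 'rV[C]_n) : v != 0 ->
  exists a : C, (a *: v) *m (a *: v)^t* = 1%:M.
Proof.
move=> /dotmx_is_dotmx v0; exists (sqrtC (dotmx v v))^-1.
have s0 : 0 < sqrtC (dotmx v v) by rewrite sqrtC_gt0.
rewrite adjmxZ -scalemxAl -scalemxAr scalerA mulmx_adj_dotmx scale_scalar_mx.
have -> : (sqrtC (dotmx v v))^-1^* = (sqrtC (dotmx v v))^-1.
  by apply: CrealP; rewrite realV gtr0_real.
congr (_%:M); rewrite -{3}(sqrtCK (dotmx v v)); field.
by rewrite gt_eqF.
Qed.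

(** Induction on the number of unmarked rows, which are zero by hypothesis. If there is one, [M] is
    singular, so some unit vector is orthogonal to all its rows and can be placed there. *)
Lemma complete_rows n (c : pred 'I_n) (M : 'M[C]_n) :
  M *m M^t* = diag_mx (\row_i (c i)%:R) ->
  exists2 W : 'M[C]_n, W \is unitarymx & forall i, c i -> row i W = row i M.
Proof.
have [m] := ubnP #|predC c|; elim: m c M => // m IHm c M le_cm cM.
have [[i ci]|all_c] := pselect (exists i, ~~ c i); last first.
  exists M => //; apply/unitarymxP; rewrite cM; apply/matrixP => i j.
  rewrite !mxE; case: (boolP (c i)) => // ci.
  by case: all_c; exists i.
have /eqP : \det (M *m M^t*) = 0.
  by rewrite cM det_diag (bigD1 i) //= mxE (negPf ci) mul0r.
rewrite det_mulmx det_map_mx det_tr mulf_eq0 fmorph_eq0 orbb => detM.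
have /det0P[v v0 vM] : \det (M^t*) == 0 by rewrite det_map_mx det_tr fmorph_eq0.
have [a] := normalize_row v0; set w := a *: v => ww.
have wM : w *m M^t* = 0 by rewrite -scalemxAl vM scaler0.
have Mw : M *m w^t* = 0 by rewrite -[M]trmxCK -adjmxM wM trmx0 map_mx0.
pose e : 'cV[C]_n := delta_mx i 0.
have ee : e *m e^t* = delta_mx i i.
  by rewrite trmx_delta map_delta_mx mul_delta_mx.
pose c' := predU1 i c.
have [||W uW rW] := IHm c' (M + e *m w).
- rewrite (leq_trans _ (ltnSE le_cm)) //; apply: proper_card.
  apply/properP; split; last by exists i; rewrite !inE ?eqxx.
  by apply/fintype.subsetP => j; rewrite !inE negb_or => /andP[].
- rewrite adjmxD adjmxM mulmxDl !mulmxDr cM mulmxA Mw mul0mx addr0.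
  rewrite -mulmxA wM mulmx0 add0r -mulmxA (mulmxA w) ww mul1mx ee.
  apply/matrixP => j k; rewrite !mxE /c' /=.
  case: (eqVneq j k) => [<-|jk]; rewrite ?mulr1n ?mulr0n ?add0r.
    by case: (eqVneq j i) => [->|]; rewrite /= ?(negPf ci) ?add0r ?addr0.
  by case: (eqVneq j i) => [<-|//]; rewrite /= eq_sym (negPf jk).
exists W => // j cj; rewrite rW /c' /= ?cj ?orbT //.
apply/rowP => k; rewrite !mxE big_ord1 !mxE.
case: (eqVneq j i) => [ji|]; last by rewrite /= mul0r addr0.
by rewrite -ji cj in ci.
Qed.

Lemma row_diag_mulmx m n (d : 'rV[C]_m) (A : 'M[C]_(m, n)) i :
  row i (diag_mx d *m A) = d 0 i *: row i A.
Proof. by rewrite row_mul row_diag_mx -scalemxAl -rowE. Qed.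

(** The entries of [s] are the norms of the rows of [H]. Nonzero rows are normalised;
    [complete_rows] fills the places of the zero rows, which [s] then annihilates. *)
Lemma orthogonal_rows_factor n (c : 'rV[C]_n) (H : 'M[C]_n) :
  H *m H^t* = diag_mx c ->
  exists s : 'rV[C]_n, exists2 W : 'M[C]_n, W \is unitarymx &
    (forall i, s 0 i \is Num.real) /\ H = diag_mx s *m W.
Proof.
move=> HH.
have rowHH i : row i H *m (row i H)^t* = (c 0 i)%:M.
  by rewrite mulmx_row_adj HH mxE eqxx.
have c_ge0 i : 0 <= c 0 i.
  have := rowHH i; rewrite mulmx_adj_dotmx => /(congr1 (fun A : 'M_1 => A 0 0)).
  rewrite !mxE /= !mulr1n => <-.
  have [->|/dotmx_is_dotmx/ltW//] := eqVneq (row i H) 0.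
  by rewrite dotmxE mul0mx mxE.
pose s := \row_i sqrtC (c 0 i).
have sR i : s 0 i \is Num.real by rewrite mxE ger0_real // sqrtC_ge0.
pose t := map_mx GRing.inv s.
have [|W uW rW] := complete_rows (c := fun i => c 0 i != 0) (M := diag_mx t *m H).
  rewrite adjmxM mulmxA -(mulmxA _ H) HH adjmx_diag !mulmx_diag.
  apply/matrixP => i j; rewrite !mxE.
  case: (eqVneq i j) => [_|_]; rewrite ?mulr0n ?mul0r ?mulr0 //.
  have sV : (sqrtC (c 0 i))^-1^* = (sqrtC (c 0 i))^-1.
    by apply: CrealP; rewrite realV ger0_real // sqrtC_ge0.
  rewrite !mulr1n sV.
  have [ci0|ci0] := eqVneq (c 0 i) 0; first by rewrite ci0 mulr0 mul0r.
  rewrite -{2}(sqrtCK (c 0 i)) /=; field.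
  by rewrite sqrtC_eq0.
exists s; exists W => //; split => //.
apply/row_matrixP => i; rewrite row_diag_mulmx.
have [ci0|ci0] := eqVneq (c 0 i) 0.
  rewrite mxE ci0 sqrtC0 scale0r; apply: mulmx_adj_eq0.
  by rewrite rowHH ci0; apply/matrixP => ? ?; rewrite !mxE mul0rn.
by rewrite rW // row_diag_mulmx scalerA !mxE mulfV ?scale1r // sqrtC_eq0.
Qed.

(** If [P] diagonalises [G G^*], the rows of [P G] are orthogonal, so [P G = diag s W] with [s]
    real. Then [V = W^* P] gives [G V = P^* diag s P], which is hermitian. *)
Lemma polar n (G : 'M[C]_n) :
  exists2 V : 'M[C]_n, V \is unitarymx & (G *m V)^t* = G *m V.
Proof.
have GG : G *m G^t* \is normalmx.
  by apply/normalmxP; rewrite adjmxM trmxCK.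
have uP := spectral_unitarymx (G *m G^t*).
have /orthomx_spectralP := GG; rewrite invmx_unitary //.
set P := spectralmx _ in uP *; set c := spectral_diag _ => eG.
have [|s [W uW [sR eH]]] := orthogonal_rows_factor (c := c) (H := P *m G).
  rewrite adjmxM mulmxA -(mulmxA P) eG !mulmxA (unitarymxP uP) mul1mx.
  by rewrite -mulmxA (unitarymxP uP) mulmx1.
exists (W^t* *m P); first by rewrite mul_unitarymx // trmxC_unitary.
have -> : G *m (W^t* *m P) = P^t* *m diag_mx s *m P.
  rewrite -[G]mul1mx -(unitarymxPC uP) -(mulmxA _ P G) eH !mulmxA.
  by rewrite mulmxtVK.
rewrite !adjmxM trmxCK adjmx_diag mulmxA; congr (_ *m diag_mx _ *m _).
by apply/rowP => i; rewrite mxE; apply: CrealP.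
Qed.

(** * Reflections and the exchange of projections *)

Definition is_symmetry n (J : 'M[C]_n) := J^t* = J /\ J *m J = 1%:M.

(** Take [J = 1 - 2 p] with [p] the orthogonal projection onto the row space of [Z], built from a
    Gram-Schmidt basis [B] of that space. *)
Lemma reflection m n (Z : 'M[C]_(m, n)) :
  exists J : 'M[C]_n, [/\ is_symmetry J, Z *m J = - Z &
    forall p (A : 'M[C]_(p, n)), A *m Z^t* = 0 -> A *m J = A].
Proof.
pose B := schmidt (row_base Z).
have uB : B \is unitarymx by rewrite schmidt_unitarymx // rank_leq_col.
have eB : (B :=: Z)%MS.
  by apply: eqmx_trans (eq_row_base Z); apply: eqmx_schmidt_free (row_base_free Z).
pose p := B^t* *m B.
have pp : p *m p = p by rewrite mulmxA mulmxtVK.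
have pA : p^t* = p by rewrite adjmxM trmxCK.
exists (1%:M - 2%:R *: p); split.
- split; first by rewrite adjmxB adjmxZ adjmx_scalar pA conjC1 conjC_nat.
  rewrite mulmxBl !mulmxBr !mul1mx mulmx1 -scalemxAl -scalemxAr pp.
  by rewrite scalerA -[p in 2%:R *: p]scale1r; apply/matrixP => i j; rewrite !mxE; ring.
- have /submxP[D ->] : (Z <= B)%MS by rewrite eB.
  rewrite mulmxBr mulmx1 -scalemxAr mulmxA mulmxtVK //.
  by apply/matrixP => i j; rewrite !mxE; ring.
- move=> q A AZ; rewrite mulmxBr mulmx1 -scalemxAr mulmxA.
  have /submxP[D ->] : (B <= Z)%MS by rewrite eB.
  by rewrite adjmxM !mulmxA AZ !mul0mx scaler0 subr0.
Qed.

Lemma symmetry_between_frames k n (X Y : 'M[C]_(k, n)) :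
  X \is unitarymx -> Y \is unitarymx ->
  exists2 J : 'M[C]_n, is_symmetry J &
    J^t* *m (X^t* *m X) *m J = Y^t* *m Y.
Proof.
move=> uX uY; have [V uV hV] := polar (X *m Y^t*).
pose Y' := V^t* *m Y.
have uY' : Y' \is unitarymx by rewrite mul_unitarymx ?trmxC_unitary.
have YY : Y'^t* *m Y' = Y^t* *m Y.
  by rewrite adjmxM trmxCK mulmxA -(mulmxA _ V) (unitarymxP uV) mulmx1.
have XY : X *m Y'^t* = Y' *m X^t*.
  rewrite -[in RHS](trmxCK Y') -adjmxM.
  by rewrite /Y' adjmxM trmxCK !mulmxA hV.
have [J [sJ ZJ oJ]] := reflection (X - Y').
have J1 : (X + Y') *m J = X + Y'.
  apply: oJ; rewrite adjmxB mulmxDl !mulmxBr (unitarymxP uX) (unitarymxP uY') XY.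
  by rewrite addrC addrA subrK subrr.
exists J => //.
(* [X] is half the sum of [X + Y'], which [J] fixes, and [X - Y'], which [J] negates. *)
have XJ : X *m J = Y'.
  have two : 2%:R != 0 :> C by rewrite pnatr_eq0.
  apply: (scalerI two).
  have -> : 2%:R *: (X *m J) = (X + Y') *m J + (X - Y') *m J.
    by rewrite -mulmxDl addrACA subrr addr0 scaler_nat mulr2n mulmxDl.
  by rewrite J1 ZJ opprB addrC addrA subrK scaler_nat mulr2n.
by rewrite mulmxA -adjmxM -mulmxA XJ YY.
Qed.

(** * Normality from the trace identity *)

(** The last term is symmetric in [A] and [B] by cyclicity, so only the terms linear in [a] and [b]
    survive when the traces for [T, T^*] and for [T^*, T] are subtracted. *)
Lemma mxtrace_rank1_perturbation n (a b : C) (A B p : 'M[C]_n) :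
  \tr (A *m (1%:M + b *: p) *m B *m (1%:M + a *: p)) =
  \tr (A *m B) + a * \tr (A *m B *m p) + b * \tr (B *m A *m p)
  + b * a * \tr (A *m p *m B *m p).
Proof.
rewrite !(mulmxDl, mulmxDr) !mulmx1 -!(scalemxAl, scalemxAr).
rewrite !mxtraceD !mxtraceZ (mxtrace_mulC (A *m p) B) !mulmxA; ring.
Qed.

Lemma normal_of_trace_symmetry n (T : 'M[C]_n) :
  (forall U : 'M[C]_n, U \is unitarymx ->
    \tr (T *m (U^t* *m T *m U)^t*) = \tr (T^t* *m (U^t* *m T *m U))) ->
  T \is normalmx.
Proof.
move=> trT; pose K := T *m T^t* - T^t* *m T.
suff K0 : K = 0 by apply/normalmxP/eqP; rewrite -subr_eq0 -/K K0.
have /orthomx_spectralP : K \is normalmx.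
  by apply/normalmxP; rewrite /K adjmxB !adjmxM !trmxCK.
have uP := spectral_unitarymx K; rewrite invmx_unitary //.
set P := spectralmx K in uP *; set c := spectral_diag K => eK.
(* The commutator [K] is hermitian, so it suffices to kill its eigenvalues; for [x] a unit
   eigenvector, [tr (K p)] is the eigenvalue. *)
suff c0 : c = 0 by rewrite eK c0 linear0 mulmx0 mul0mx.
apply/rowP => i; rewrite [RHS]mxE.
set x := row i P; have xx : x *m x^t* = 1%:M.
  by rewrite mulmx_row_adj (unitarymxP uP) mxE eqxx.
have xK : x *m K = c 0 i *: x.
  by rewrite eK !mulmxA -!row_mul (unitarymxP uP) mul1mx row_diag_mulmx.
pose p := x^t* *m x.
have pA : p^t* = p by rewrite adjmxM trmxCK.
have pp : p *m p = p by rewrite /p mulmxA -(mulmxA (x^t*)) xx mulmx1.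
have trKp : \tr (K *m p) = c 0 i.
  by rewrite /p mulmxA mxtrace_mulC mulmxA xK -scalemxAl xx mxtraceZ mxtrace1 mulr1.
(* [U] multiplies [x] by ['i] and fixes its orthogonal complement. A non-real factor is essential:
   the difference of the two traces is [a - a^*] times [tr (K p)]. *)
pose a : C := 'i - 1.
pose U := 1%:M + a *: p.
have aC : a^* = - 'i - 1 by rewrite rmorphB /= conjCi conjC1.
have UA : U^t* = 1%:M + a^* *: p by rewrite adjmxD adjmx_scalar conjC1 adjmxZ pA.
have uU : U \is unitarymx.
  apply/unitarymxP; rewrite UA mulmxDl !mulmxDr !mul1mx mulmx1 -scalemxAl -scalemxAr.
  rewrite pp scalerA -addrA -!scalerDl aC.
  have -> : - 'i - 1 + (a + a * (- 'i - 1)) = - (1 + 'i ^+ 2) :> C by rewrite /a; ring.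
  by rewrite sqrCi subrr oppr0 scale0r addr0.
have := trT U uU; rewrite !adjmxM trmxCK UA !mulmxA !mxtrace_rank1_perturbation.
rewrite (mxtrace_mulC T).
have -> : \tr (T *m p *m T^t* *m p) = \tr (T^t* *m p *m T *m p).
  by rewrite -(mulmxA (T *m p)) mxtrace_mulC !mulmxA.
move: trKp; rewrite mulmxBl raddfB /= => <- /eqP.
rewrite -subr_eq0 => /eqP E.
have : (a - a^*) * (\tr (T *m T^t* *m p) - \tr (T^t* *m T *m p)) = 0.
  by rewrite -E; ring.
have -> : a - a^* = 2%:R * 'i by rewrite aC /a; ring.
by move=> /eqP; rewrite !mulf_eq0 pnatr_eq0 /= (negPf (neq0Ci _)) /= => /eqP.
Qed.

(** * Eigenvectors and orbits of diagonalised matrices *)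

Lemma row_eigenvector n (P : 'M[C]_n) (t : 'rV[C]_n) l : P \is unitarymx ->
  row l P *m (P^t* *m diag_mx t *m P) = t 0 l *: row l P.
Proof.
by move=> uP; rewrite !mulmxA -!row_mul (unitarymxP uP) mul1mx row_diag_mulmx.
Qed.

Lemma row_unitary_neq0 n (P : 'M[C]_n) l : P \is unitarymx -> row l P != 0.
Proof.
move=> /unitarymxP/(congr1 (row l)); rewrite row_mul row1; apply: contra_eq_neq => ->.
rewrite mul0mx; apply/eqP => /rowP/(_ l); rewrite !mxE !eqxx => /esym/eqP.
by rewrite oner_eq0.
Qed.

(** Compare coordinates in the eigenbasis [P]. For two matrices diagonalised by the same [P], a
    common eigenvector yields one index carrying both eigenvalues. *)
Lemma eigenvector_coord n (P : 'M[C]_n) (t w : 'rV[C]_n) a l : P \is unitarymx ->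
  w *m (P^t* *m diag_mx t *m P) = a *: w -> (w *m P^t*) 0 l != 0 -> t 0 l = a.
Proof.
move=> uP /(congr1 (mulmx^~ (P^t*))); rewrite !mulmxA mulmxtVK // -scalemxAl.
move=> /(congr1 (fun v : 'rV_n => v 0 l)); rewrite mul_mx_diag [LHS]mxE [RHS]mxE mulrC.
by move=> e wl; apply: (mulIf wl).
Qed.

Lemma conj_perm_diag n (s : 'S_n) (t : 'rV[C]_n) :
  (perm_mx s)^t* *m diag_mx t *m perm_mx s = diag_mx (\row_l t 0 ((s^-1)%g l)).
Proof.
rewrite tr_perm_mx map_perm_mx -row_permE -{2}[s]invgK -col_permE.
apply/matrixP => i j; rewrite !mxE.
by rewrite (inj_eq perm_inj).
Qed.

Lemma three_eigenvalues_orbit n (P : 'M[C]_n) (t : 'rV[C]_n) i j k :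
  P \is unitarymx -> t 0 i != t 0 j -> t 0 j != t 0 k -> t 0 i != t 0 k ->
  let T := P^t* *m diag_mx t *m P in
  exists2 U : 'M[C]_n, U \is unitarymx &
    forall J, is_symmetry J -> J^t* *m T *m J <> U^t* *m T *m U.
Proof.
move=> uP tij tjk tik T.
have neq x y : t 0 x != t 0 y -> x != y by apply: contraNneq => ->.
(* The inverse of [s] is the cycle sending [i] to [j], [j] to [k] and [k] to [i]; it is the inverse
   that permutes the diagonal in [conj_perm_diag]. *)
pose s : 'S_n := (tperm i j * tperm i k)^-1%g.
have si : (s^-1)%g i = j.
  by rewrite invgK permM tpermL tpermD // ?(eq_sym k) neq // 1?eq_sym.
have sj : (s^-1)%g j = k by rewrite invgK permM tpermR tpermL.
have sl l : l != i -> l != j -> l != k -> (s^-1)%g l = l.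
  by move=> li lj lk; rewrite invgK permM !tpermD // eq_sym.
exists (P^t* *m perm_mx s *m P).
  rewrite !mul_unitarymx ?trmxC_unitary //; apply/unitarymxP.
  by rewrite tr_perm_mx map_perm_mx -perm_mxM mulgV perm_mx1.
move=> J [JA JJ]; rewrite JA !adjmxM trmxCK.
have -> : P^t* *m ((perm_mx s)^t* *m P) *m T *m (P^t* *m perm_mx s *m P) =
    P^t* *m diag_mx (\row_l t 0 ((s^-1)%g l)) *m P.
  rewrite -conj_perm_diag /T !mulmxA !mulmxtVK //.
set S := _ *m diag_mx (\row__ _) *m _ => eS.
have vT := row_eigenvector t i uP; rewrite -/T in vT.
have vS := row_eigenvector (\row_l t 0 ((s^-1)%g l)) i uP.
rewrite -/S mxE si in vS.
(* Since [J T J = S] and [J J = 1], we have [J T = S J] and [J S = T J], so [J] exchanges the two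
   eigenvalues of row [i]. *)
have wT : row i P *m J *m T = t 0 j *: (row i P *m J).
  by rewrite scalemxAl -vS -eS !mulmxA -(mulmxA _ J J) JJ mulmx1.
have wS : row i P *m J *m S = t 0 i *: (row i P *m J).
  by rewrite scalemxAl -vT -eS !mulmxA -(mulmxA (row i P) J J) JJ mulmx1.
have [l wl] : exists l, (row i P *m J *m P^t*) 0 l != 0.
  apply/existsP; apply: contraT => /existsPn w0.
  have {}w0 : row i P *m J *m P^t* = 0.
    by apply/rowP => l; rewrite [RHS]mxE; apply/eqP; rewrite -[_ == _]negbK w0.
  have /eqP[] := row_unitary_neq0 i uP.
  by rewrite -[row i P]mulmx1 -JJ mulmxA -(mulmxKtV (row i P *m J) uP) // w0 !mul0mx.
have /= tl := eigenvector_coord uP wT wl.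
have := eigenvector_coord uP wS wl; rewrite mxE => tsl.
(* The values at [l] and at its image under the cycle must be those at [j] and at [i]. The first
   excludes [i] and [k], the second excludes [j], and any other [l] is fixed by the cycle. *)
have [li|li] := eqVneq l i; first by rewrite -tl li eqxx in tij.
have [lj|lj] := eqVneq l j; first by rewrite -tsl lj sj eqxx in tik.
have [lk|lk] := eqVneq l k; first by rewrite -tl lk eqxx in tjk.
by rewrite -tl -tsl sl // eqxx in tij.
Qed.

Lemma two_eigenvalues_orbit n (P U : 'M[C]_n) (t : 'rV[C]_n) a b :
  P \is unitarymx -> (forall i, t 0 i = a \/ t 0 i = b) -> U \is unitarymx ->
  let T := P^t* *m diag_mx t *m P in
  exists2 J, is_symmetry J & J^t* *m T *m J = U^t* *m T *m U.
Proof.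
move=> uP tab uU T.
pose I := [set i | t 0 i == a]%SET.
pose X : 'M[C]_(#|I|, n) := rowsub enum_val P.
have uX : X \is unitarymx.
  apply/unitarymxP/matrixP => i j.
  have /(congr1 (fun A : 'M_n => A (enum_val i) (enum_val j))) := unitarymxP uP.
  rewrite !mxE (inj_eq enum_val_inj) => <-.
  by apply: eq_bigr => k _; rewrite !mxE.
have eT : T = b%:M + (a - b) *: (X^t* *m X).
  have -> : b%:M = P^t* *m b%:M *m P.
    by rewrite mul_mx_scalar -scalemxAl (unitarymxPC uP) scalemx1.
  (* Summing over the selected rows of [P] is summing over all rows weighted by the indicator of
     [I]. *)
  have -> : X^t* *m X = P^t* *m diag_mx (\row_i (i \in I)%:R) *m P.
    apply/matrixP => i j; rewrite [RHS]mxE [LHS]mxE.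
    under eq_bigr do rewrite !mxE.
    rewrite -(big_enum_val (fun l => (P l i)^* * P l j)) big_mkcond /=.
    apply: eq_bigr => l _; rewrite mul_mx_diag !mxE.
    by case: (l \in I); rewrite ?mulr1 // mulr0 mul0r.
  rewrite scalemxAl scalemxAr -mulmxDl -mulmxDr /T; congr (_ *m _ *m _).
  apply/matrixP => i j; rewrite !mxE inE.
  case: (eqVneq i j) => [_|_]; last by rewrite !mulr0n mulr0 addr0.
  rewrite !mulr1n; have [->|nta] := eqVneq (t 0 i) a; first by rewrite mulr1 addrC subrK.
  by case: (tab i) => [ta|->]; [rewrite ta eqxx in nta | rewrite mulr0 addr0].
have [J sJ eJ] := symmetry_between_frames uX (mul_unitarymx uX uU).
exists J => //; have [JA JJ] := sJ.
(* Conjugation by a unitary preserves scalars, so only the projection has to be moved. *)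
have conjT (V : 'M[C]_n) : V^t* *m V = 1%:M ->
    V^t* *m T *m V = b%:M + (a - b) *: (V^t* *m (X^t* *m X) *m V).
  move=> VV; rewrite eT mulmxDr mulmxDl mul_mx_scalar -scalemxAl VV scalemx1.
  by rewrite -scalemxAr -scalemxAl.
have JJ' : J^t* *m J = 1%:M by rewrite JA.
by rewrite (conjT J JJ') (conjT U (unitarymxPC uU)) eJ adjmxM !mulmxA.
Qed.

Lemma eigenvalue_unitary_diag n (P : 'M[C]_n) (t : 'rV[C]_n) a : P \is unitarymx ->
  eigenvalue (P^t* *m diag_mx t *m P) a <-> exists i, a = t 0 i.
Proof.
move=> uP; split=> [/eigenvalueP[w wT w0]|[i ->]]; last first.
  apply/eigenvalueP; exists (row i P); first exact: row_eigenvector.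
  exact: row_unitary_neq0.
have /existsP[l wl] : [exists l, (w *m P^t*) 0 l != 0].
  apply: contraNT w0 => /existsPn w0; apply/eqP.
  rewrite -(mulmxKtV w uP) //; suff -> : w *m P^t* = 0 by rewrite mul0mx.
  by apply/rowP => l; rewrite [RHS]mxE; apply/eqP; rewrite -[_ == _]negbK w0.
by exists l; rewrite (eigenvector_coord uP wT wl).
Qed.

End Orbits.

(** * Sets with at most two elements, and the equivalence *)

Lemma card_le_II2P (T : Type) (A : set T) :
  A #<= `I_2 <->
  forall x y z, A x -> A y -> A z -> [\/ x = y, y = z | x = z].
Proof.
split=> [A2 x y z Ax Ay Az|A3].
  apply: contrapT => ne3.
  have [xy yz xz] : [/\ x <> y, y <> z & x <> z].
    by split=> e; apply: ne3; [constructor 1 | constructor 2 | constructor 3].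
  pose f n := if n == 0%N then x else if n == 1%N then y else z.
  have fA : f @` `I_3 `<=` A by move=> _ [[|[|[|//]]] _ <-].
  have finj : {in `I_3 &, injective f}.
    move=> m p /set_mem /= m3 /set_mem /= p3; rewrite /f.
    by case: m m3 => [|[|[|//]]] _; case: p p3 => [|[|[|//]]] _ //= e; congruence.
  have : `I_3 #<= `I_2.
    apply: card_le_trans (card_le_trans (subset_card_le fA) A2).
    by have /card_eqPle[] := inj_card_eq finj.
  by rewrite card_le_II.
have [->|/set0P[x Ax]] := eqVneq A set0; first by rewrite card_ge0.
suff [y Ay] : exists y, A `<=` [set x; y].
  apply: card_le_trans (subset_card_le Ay) _.
  apply: card_le_trans (card_image_le (fun n => if n == 0%N then x else y) _).
  by apply: subset_card_le => _ [] ->; [exists 0%N | exists 1%N].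
(* If [A] is the singleton of [x], the second point may be [x] again. *)
have [[y [Ay yx]]|Ax1] := pselect (exists y, A y /\ y <> x).
  by exists y => z Az; have [/yx|<-|<-] := A3 y x z Ay Ax Az; [|left|right].
by exists x => z Az; left; apply: contrapT => zx; apply: Ax1; exists z.
Qed.

Lemma two_values (T : Type) n (t : 'I_n -> T) (x0 : T) :
  (forall i j k, [\/ t i = t j, t j = t k | t i = t k]) ->
  exists a b, forall i, t i = a \/ t i = b.
Proof.
move=> t3.
have [[i [j tij]]|tc] := pselect (exists i j, t i <> t j).
  exists (t i), (t j) => k.
  by have [/tij|<-|<-] := t3 i j k; [|right|left].
(* A constant family takes [a = b]; the default [x0] serves the empty family. *)
case: n t t3 tc => [|n] t t3 tc; first by exists x0, x0 => -[].
exists (t ord0), (t ord0) => i; left; apply: contrapT => ne.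
by apply: tc; exists i, ord0.
Qed.

Local Open Scope complex_scope.

Theorem theorem5p18 (R : realType) (d : nat) (hd : (1 <= d)%N)
    (T : 'M[R[i]]_d) :
  symmetry_orbit T = unitary_orbit T <->
  T \is normalmx /\ spectrum T #<= `I_2.
Proof.
have symE (J : 'M[R[i]]_d) : symmetries J <-> is_symmetry J.
  split=> [[uJ JA JV]|[JA JJ]].
    by split=> //; rewrite {2}JV mulmxV.
  have [uJ _] := mulmx1_unit JJ.
  by split=> //; rewrite -[LHS]mulmx1 -(mulmxV uJ) mulmxA JJ mul1mx.
have sub : symmetry_orbit T `<=` unitary_orbit T.
  move=> _ [J /symE[JA JJ] <-]; exists J => //=.
  by apply/unitarymxP; rewrite JA.
split=> [eTU|[nT]].
  have orbJ U : U \is unitarymx ->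
      exists2 J, is_symmetry J & J^t* *m T *m J = U^t* *m T *m U.
    move=> uU; have : unitary_orbit T (U^t* *m T *m U) by exists U.
    by rewrite -eTU => -[J /symE sJ eJ]; exists J.
  have nT : T \is normalmx.
    apply: normal_of_trace_symmetry => U /orbJ[J [JA JJ] <-].
    (* One cyclic rotation turns [tr (T J T^* J)] into [tr (T^* J T J)]. *)
    rewrite !adjmxM trmxCK JA mulmxA mulmxA -(mulmxA (T *m J)) mxtrace_mulC.
    by rewrite !mulmxA.
  split=> //.
  have uP := spectral_unitarymx T; have /orthomx_spectralP := nT.
  rewrite invmx_unitary //; move: (spectralmx T) (spectral_diag T) uP => P t uP eT.
  have eigP := eigenvalue_unitary_diag t _ uP; apply/card_le_II2P => x y z; rewrite /spectrum /= eT.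
  move=> /eigP[i ->] /eigP[j ->].
  move=> /eigP[k ->].
  apply: contrapT => ne3.
  have [tij tjk tik] : [/\ t 0 i != t 0 j, t 0 j != t 0 k & t 0 i != t 0 k].
    by split; apply/eqP => e; apply: ne3; [constructor 1 | constructor 2 | constructor 3].
  have [U uU nU] := three_eigenvalues_orbit uP tij tjk tik.
  have [J sJ] := orbJ U uU; rewrite eT; exact: nU.
move=> T2; apply/seteqP; split=> // _ [U uU <-].
have uP := spectral_unitarymx T; have /orthomx_spectralP := nT.
rewrite invmx_unitary //; move: (spectralmx T) (spectral_diag T) uP => P t uP eT.
have eigP := eigenvalue_unitary_diag t _ uP.
have spT l : spectrum T (t 0 l).
  rewrite /spectrum /= eT; exact (proj2 (eigP _) (ex_intro _ l erefl)).
have [a [b tab]] : exists a b, forall i, t 0 i = a \/ t 0 i = b.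
  by apply: (two_values 0) => i j k; move/card_le_II2P: T2; apply.
have [J sJ eJ] := two_eigenvalues_orbit uP tab uU.
by exists J; [apply/symE | rewrite eT].
Qed.
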